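(* The $\beta$-dimensional quantization coefficient of $P$ for $\beta=1$ does not exist; that is, $\lim_{n\to\infty}n^2V_n(P)$ does not exist.
   Context: Let $S_1,S_2,S_3:\mathbb{R}^2\to\mathbb{R}^2$ be $S_1(x_1,x_2)=\frac13(x_1,x_2)$, $S_2(x_1,x_2)=\frac13(x_1,x_2)+\frac23(1,0)$, $S_3(x_1,x_2)=\frac13(x_1,x_2)+\frac23(\frac12,\frac{\sqrt3}{2})$. Let $P$ be the unique Borel probability measure on $\mathbb{R}^2$ with $P=\frac13\sum_{j=1}^3 P\circ S_j^{-1}$; its support is the limit set of $\{S_1,S_2,S_3\}$ (the stretched Sierpiński triangle). For $n\in\mathbb{N}$ the $n$th quantization error of $P$ is $V_n=V_n(P)=\inf\left\{\int\min_{a\in\alpha}\|x-a\|^2\,dP(x):\alpha\subset\mathbb{R}^2,\ \alpha\neq\emptyset,\ \mathrm{card}(\alpha)\le n\right\}$, with $\|\cdot\|$ the Euclidean norm. For $s\in(0,\infty)$, the $s$-dimensional quantization coefficient of $P$ is $\lim_{n\to\infty}n^{2/s}V_n(P)$, if this limit exists. *)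

(* Defs.v *)
From HB Require Import structures.
From mathcomp Require Import all_boot all_order all_algebra.
From mathcomp Require Import all_classical all_reals all_analysis.
From mathcomp Require Import lra.

Set Implicit Arguments.
Unset Strict Implicit.
Unset Printing Implicit Defensive.

Import Order.TTheory GRing.Theory Num.Theory.
Import numFieldNormedType.Exports.

Local Open Scope classical_set_scope.
Local Open Scope card_scope.
Local Open Scope ring_scope.

(* The plane is [R * R] with the product of the Borel sigma-algebras of [R];
   [measurable_plane_borel] checks that this is the Borel sigma-algebra of the
   plane. The library norm on [R * R] is the max norm, hence [enorm]. *)

Lemma measurable_plane_borel (R : realType) :
  @measurable _ (R * R)%type = <<s [set A : set (R * R) | open A] >>.
Proof.
rewrite eqEsubset; split.
- apply: smallest_sub; first exact: smallest_sigma_algebra.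
  have preim (f : R * R -> R) : continuous f ->
      preimage_set_system setT f measurable
        `<=` <<s [set A : set (R * R) | open A] >>.
    move=> cf.
    have : @measurable_fun _ _ (g_sigma_algebraType [set A : set (R * R) | open A])
        (measurableTypeR R) setT f.
      apply: (measurability _ (measurable_realfun.RGenOpens.measurableE R)).
      move=> _ [_ [x [y ->]] <-]; rewrite setTI.
      apply: sub_sigma_algebra => /=.
      by move/continuousP: cf; apply; exact: interval_open.
    by move=> mf _ [A mA <-]; exact: mf.
  rewrite subUset; split; apply: preim => x; [exact: cvg_fst|exact: cvg_snd].
- apply: smallest_sub; first exact: sigma_algebra_measurable.
  move=> A oA.
  pose B (q : (rat * rat) * (rat * rat)) : set (R * R) :=
    `]ratr q.1.1, ratr q.1.2[ `*` `]ratr q.2.1, ratr q.2.2[.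
  have -> : A = \bigcup_q (if `[< B q `<=` A >] then B q else set0).
    rewrite eqEsubset; split=> [[x y] Axy|x [q _]]; last first.
      by case: ifPn => // /asboolP; apply.
    move: oA; rewrite openE => /(_ _ Axy)/nbhs_ballP[e/= e0 eA].
    have [a] := @rat_in_itvoo R (x - e) x ltac:(by rewrite ltrBlDr ltrDl).
    have [b] := @rat_in_itvoo R x (x + e) ltac:(by rewrite ltrDl).
    have [c] := @rat_in_itvoo R (y - e) y ltac:(by rewrite ltrBlDr ltrDl).
    have [d] := @rat_in_itvoo R y (y + e) ltac:(by rewrite ltrDl).
    rewrite !in_itv/= => /andP[yd de] /andP[ec cy] /andP[xb be] /andP[ea ax].
    exists ((a, b), (c, d)) => //.
    rewrite asboolT; first by split; rewrite /= in_itv/=; apply/andP.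
    move=> [s t] [/=]; rewrite !in_itv/= => /andP[as_ sb] /andP[ct td].
    apply: eA; split; rewrite /ball/= ltr_norml; apply/andP; split; lra.
  apply: countable_bigcupT_measurable => [|q]; first exact: countableP.
  by case: ifPn => // _; apply: measurableX; exact: measurable_itv.
Qed.

Definition enorm (R : realType) (x : R * R) : R :=
  Num.sqrt (x.1 ^+ 2 + x.2 ^+ 2).

Definition contraction (R : realType) (v x : R * R) : R * R :=
  (3^-1 * x.1 + 2 / 3 * v.1, 3^-1 * x.2 + 2 / 3 * v.2).

Definition S1 (R : realType) : R * R -> R * R := contraction (0, 0).
Definition S2 (R : realType) : R * R -> R * R := contraction (1, 0).
Definition S3 (R : realType) : R * R -> R * R :=
  contraction (2^-1, Num.sqrt 3 / 2).

(* This equation has exactly one solution among the Borel probability measures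
   on the plane. *)
Definition self_similar (R : realType) (P : probability (R * R)%type R) : Prop :=
  forall A : set (R * R), measurable A ->
    P A = ((3^-1)%:E * (pushforward P (@S1 R) A + pushforward P (@S2 R) A
                        + pushforward P (@S3 R) A))%E.

(* For [alpha] finite and nonempty the infimum is the minimum. *)
Definition sqdist (R : realType) (alpha : set (R * R)) (x : R * R) : R :=
  inf [set enorm (x - a) ^+ 2 | a in alpha].

(* [alpha #<= `I_n]: [alpha] is finite, with at most [n] elements. *)
Definition quantization_error (R : realType) (P : probability (R * R)%type R)
    (n : nat) : \bar R :=
  ereal_inf [set (\int[P]_x (sqdist alpha x)%:E)%E
            | alpha in [set alpha : set (R * R) |
                        alpha !=set0 /\ alpha #<= `I_n]].

(* Values are taken in [\bar R], so that divergence to [+oo] counts as having a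
   limit. *)
Definition is_quantization_coefficient (R : realType)
    (P : probability (R * R)%type R) (s : R) (c : \bar R) : Prop :=
  ((n%:R `^ (2 / s))%:E * quantization_error P n)%E @[n --> \oo] --> c.

(* Main.v *)
Require Import Defs.
From HB Require Import structures.
From mathcomp Require Import all_boot all_order all_algebra.
From mathcomp Require Import all_classical all_reals all_analysis.
From mathcomp Require Import ring lra measurable_realfun.

(** Write [V n] for the quantization error. The sequence [n ^ 2 * V n] is
    at most [1 / 6] along [n = 3 ^ k] and at least [8 / 27] along
    [n = 2 * 3 ^ k]. Since [1 / 6 < 8 / 27], it has no limit, finite or infinite.

    Both bounds come from iterating the self-similarity [m] times
    ([integral_corners]): the integral of [f] is the average over the [3 ^ m]
    corners [t], the images of the origin under the words of length [m], of the
    integral of [f (3 ^ - m * u + t)] in [u].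

    Lower bound. For fixed [u] the points [3 ^ - m * u + t] form a translate of
    the set of corners, in which distinct points are at distance at least
    [2 * 3 ^ - m] ([corners_separated]): siblings realise this value, and cells
    of different parents are farther apart because level one cells are at
    distance [1 / 3]. If [n] centres serve [N] points at mutual squared distance
    at least [d], then a centre serving [s] of them costs at least
    [d / 2 * (s - 1)] by the parallel axis theorem ([sum_sqr_cluster_ge]), so
    that the whole costs at least [d / 2 * (N - n)] ([sum_sqdist_ge]). This
    holds for every [u], whence
    [V n >= 2 * 27 ^ - m * (3 ^ m - n)]. The choice [n = 2 / 3 * 3 ^ m], which
    maximises [n ^ 2 * (3 ^ m - n)], gives [8 / 27].

    Upper bound. One centre per cell of level [m], the image of the centroid of
    the triangle, gives [V (3 ^ m) <= 9 ^ - m * W] where [W] is the second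
    moment about the centroid ([quantization_error_le]). Self-similarity yields
    [W = W / 9 + 4 / 27]. This determines [W = 1 / 6] as soon as [W] is finite,
    which follows from the boundedness of the support ([probability_box2]). *)

Set Implicit Arguments.
Unset Strict Implicit.
Unset Printing Implicit Defensive.

Import Order.TTheory GRing.Theory Num.Theory.
Import numFieldNormedType.Exports.
(* Makes [contraction] denote the similarities of the plane again, rather than
   the Lipschitz maps of fixed point theory. *)
Import Defs.

Local Open Scope classical_set_scope.
Local Open Scope ring_scope.

(** * The cost of serving separated points *)

Lemma enorm_sqr (R : realType) (x : R * R) : enorm x ^+ 2 = x.1 ^+ 2 + x.2 ^+ 2.
Proof. by rewrite sqr_sqrtr// addr_ge0 ?sqr_ge0. Qed.

(** The two sides differ by twice the square of the sum of the [f x]: this is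
    the parallel axis theorem with the term of the mean dropped. *)
Lemma sum_sqr_diff_le (R : realType) (T : Type) (s : seq T) (f : T -> R) :
  \sum_(x <- s) \sum_(y <- s) (f x - f y) ^+ 2 <=
  2 * (size s)%:R * \sum_(x <- s) f x ^+ 2.
Proof.
have inner x : \sum_(y <- s) (f x - f y) ^+ 2 =
    (size s)%:R * f x ^+ 2 - 2 * f x * (\sum_(y <- s) f y)
    + \sum_(y <- s) f y ^+ 2.
  have -> : (size s)%:R * f x ^+ 2 = \sum_(y <- s) f x ^+ 2.
    by rewrite big_const_seq count_predT iter_addr addr0 mulr_natl.
  rewrite mulr_sumr -sumrB -big_split/=; apply: eq_bigr => y _; ring.
under eq_bigr do rewrite inner.
rewrite big_split/= sumrB -mulr_sumr -mulr_suml -mulr_sumr.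
rewrite big_const_seq count_predT iter_addr addr0 -mulr_natl.
have := sqr_ge0 (\sum_(y <- s) f y); lra.
Qed.

(** Summing the squared mutual distances over ordered pairs gives at least
    [s * (s - 1) * d] by separation, and at most [2 * s] times the right-hand
    side by [sum_sqr_diff_le] in each coordinate. *)
Lemma sum_sqr_cluster_ge (R : realType) (d : R) (s : seq (R * R)) (a : R * R) :
  0 <= d -> uniq s ->
  {in s &, forall x y, x != y -> d <= enorm (x - y) ^+ 2} ->
  d / 2 * ((size s)%:R - 1) <= \sum_(x <- s) enorm (x - a) ^+ 2.
Proof.
move=> d0 us sep.
have [/size0nil->|s0] := eqVneq (size s) 0%N; first by rewrite big_nil/=; nra.
have s0' : 0 < (size s)%:R :> R by rewrite ltr0n lt0n.
have up : \sum_(x <- s) \sum_(y <- s) enorm (x - y) ^+ 2 <=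
    2 * (size s)%:R * \sum_(x <- s) enorm (x - a) ^+ 2.
  have -> : \sum_(x <- s) enorm (x - a) ^+ 2 =
      \sum_(x <- s) (x.1 - a.1) ^+ 2 + \sum_(x <- s) (x.2 - a.2) ^+ 2.
    by rewrite -big_split; apply: eq_bigr => x _; rewrite enorm_sqr.
  have -> : \sum_(x <- s) \sum_(y <- s) enorm (x - y) ^+ 2 =
      \sum_(x <- s) \sum_(y <- s) ((x.1 - a.1) - (y.1 - a.1)) ^+ 2
      + \sum_(x <- s) \sum_(y <- s) ((x.2 - a.2) - (y.2 - a.2)) ^+ 2.
    rewrite -big_split; apply: eq_bigr => x _; rewrite -big_split.
    by apply: eq_bigr => y _; rewrite enorm_sqr/=; ring.
  by rewrite mulrDr lerD// sum_sqr_diff_le.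
have lo : (size s)%:R * (d * ((size s)%:R - 1)) <=
    \sum_(x <- s) \sum_(y <- s) enorm (x - y) ^+ 2.
  have -> : (size s)%:R * (d * ((size s)%:R - 1)) =
      \sum_(x <- s) (d * ((size s)%:R - 1)).
    by rewrite big_const_seq count_predT iter_addr addr0 mulr_natl.
  rewrite big_seq [leRHS]big_seq; apply: ler_sum => x xs.
  have -> : (size s)%:R - 1 = \sum_(y <- s) (1 - (y == x)%:R) :> R.
    rewrite sumrB big_const_seq count_predT iter_addr addr0.
    rewrite [X in _ = _ - X](bigD1_seq x)//= eqxx big1 ?addr0// => y /negbTE-> //.
  rewrite mulr_sumr big_seq [leRHS]big_seq; apply: ler_sum => y ys.
  have [->|xy] := eqVneq y x; first by rewrite subrr mulr0 sqr_ge0.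
  by rewrite subr0 mulr1 sep// eq_sym.
rewrite -(ler_pM2l s0'); lra.
Qed.

(** Assign each point to a nearest centre and apply [sum_sqr_cluster_ge] to each
    cluster. For an empty cluster that lemma gives a nonpositive bound, so that
    every centre can be charged for one point, whether it serves any or not. *)
Lemma sum_sqdist_ge (R : realType) (d : R) (s : seq (R * R)) (n : nat)
    (alpha : set (R * R)) :
  0 <= d -> uniq s ->
  {in s &, forall x y, x != y -> d <= enorm (x - y) ^+ 2} ->
  alpha !=set0 -> (alpha #<= `I_n)%card ->
  d / 2 * ((size s)%:R - n%:R) <= \sum_(x <- s) sqdist alpha x.
Proof.
move=> d0 us sep [a0 aa0] /pcard_surjP[g gs].
(* [g] enumerates [alpha], possibly with values outside [alpha]; such values
   can only lower the cost of the clusters. *)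
have [i0 /= i0n _] := gs _ aa0.
pose c x := [arg min_(i < Ordinal i0n) enorm (x - g i) ^+ 2]%O.
have cP x : enorm (x - g (c x)) ^+ 2 <= sqdist alpha x.
  apply: lb_le_inf; first by exists (enorm (x - a0) ^+ 2), a0.
  move=> _ [a /gs[i/= iN <-] <-]; rewrite /c; case: arg_minP => // j _ jmin.
  exact: (jmin (Ordinal iN)).
apply: le_trans (ler_sum _ (fun x _ => cP x)).
rewrite (partition_big c xpredT)//=.
have -> : (size s)%:R = \sum_(j < n) (size [seq x <- s | c x == j])%:R :> R.
  under eq_bigr do rewrite size_filter -sum1_count.
  rewrite -natr_sum; congr (_%:R).
  by rewrite -sum1_size (partition_big c xpredT).
have -> : n%:R = \sum_(j < n) 1 :> R by rewrite sumr_const card_ord.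
rewrite -sumrB mulr_sumr; apply: ler_sum => j _.
rewrite (_ : \sum_(i <- s | _) _ =
  \sum_(i <- [seq x <- s | c x == j]) enorm (i - g j) ^+ 2).
  apply: sum_sqr_cluster_ge => //; first exact: filter_uniq.
  by move=> x y; rewrite !mem_filter => /andP[_ xs] /andP[_ ys]; apply: sep.
by rewrite big_filter; apply: eq_bigr => x /eqP->.
Qed.

(** * The corners of the cells *)

Definition vertices (R : realType) : seq (R * R) :=
  [:: (0, 0); (1, 0); (2^-1, Num.sqrt 3 / 2)].

(** The images of the vertex [(0, 0)] under the words of length [m] in the three
    similarities. *)
Fixpoint corners (R : realType) (m : nat) : seq (R * R) :=
  if m is m'.+1 then
    [seq contraction v t | v <- vertices R, t <- corners R m']
  else [:: (0, 0)].

Arguments corners : simpl never.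

Lemma cornersS (R : realType) m :
  corners R m.+1 = [seq contraction v t | v <- vertices R, t <- corners R m].
Proof. by []. Qed.

Lemma mem_corners0 (R : realType) (t : R * R) : t \in corners R 0 -> t = (0, 0).
Proof. by move=> t0; apply/eqP; rewrite -mem_seq1. Qed.

Lemma size_corners (R : realType) m : size (corners R m) = (3 ^ m)%N.
Proof. by elim: m => // m IH; rewrite expnS -IH cornersS size_allpairs. Qed.

(** The convex hull of the vertices is cut out by three strips, one
    perpendicular to each edge; this form gives the gap between cells by
    projecting on the edge that joins their vertices. *)
Definition in_triangle (R : realType) (x : R * R) :=
  [/\ 0 <= x.1 <= 1, 0 <= x.1 + Num.sqrt 3 * x.2 <= 2
    & -1 <= Num.sqrt 3 * x.2 - x.1 <= 1].

Lemma sqrt3_sqr (R : realType) : Num.sqrt 3 * Num.sqrt 3 = 3 :> R.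
Proof. by rewrite -expr2 sqr_sqrtr. Qed.

Lemma corners_in_triangle (R : realType) m (t : R * R) :
  t \in corners R m -> in_triangle t.
Proof.
have q3 := @sqrt3_sqr R.
elim: m t => [t /mem_corners0->|m IH t]; first by split => /=; lra.
case/allpairsP => -[v s] /= [vV /IH[s1 s2 s3] ->].
move: vV; rewrite !inE => /or3P[] /eqP->; split => /=; nra.
Qed.

(** Projected on the edge from [v] to [w], of length [1], the two cells are the
    two outer thirds of the edge, so they are at distance at least [1 / 3]. *)
Lemma contraction_gap (R : realType) (v w s t : R * R) :
  v \in vertices R -> w \in vertices R -> v != w ->
  in_triangle s -> in_triangle t ->
  9^-1 <= enorm (contraction v s - contraction w t) ^+ 2.
Proof.
have q3 := @sqrt3_sqr R.
move=> vV wV vw [s1 s2 s3] [t1 t2 t3]; rewrite enorm_sqr /=.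
set q := Num.sqrt 3 in q3 s2 s3 t2 t3 vV wV *.
set z1 := (X in X ^+ 2 + _); set z2 := (X in _ + X ^+ 2).
have z1E : z1 = 3^-1 * s.1 + 2 / 3 * v.1 - (3^-1 * t.1 + 2 / 3 * w.1) by [].
have z2E : q * z2 = 3^-1 * (q * s.2) + 2 / 3 * (q * v.2)
    - (3^-1 * (q * t.2) + 2 / 3 * (q * w.2)) by rewrite /z2 /=; ring.
(* [e1] and [e2] are the Pythagorean identities in the orthonormal frames of
   the two slanted edges; [h1], [h2], [h3] drop the transverse components. *)
have e1 : 4 * (z1 ^+ 2 + z2 ^+ 2) = (z1 + q * z2) ^+ 2 + (q * z1 - z2) ^+ 2.
  transitivity (z1 ^+ 2 + z2 ^+ 2 + (q * q) * (z1 ^+ 2 + z2 ^+ 2)); last ring.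
  rewrite q3; ring.
have e2 : 4 * (z1 ^+ 2 + z2 ^+ 2) = (q * z2 - z1) ^+ 2 + (q * z1 + z2) ^+ 2.
  rewrite e1; ring.
have h1 := sqr_ge0 (q * z1 - z2); have h2 := sqr_ge0 (q * z1 + z2).
have sq (a x : R) : 0 <= a -> (a <= x) || (a <= - x) -> a ^+ 2 <= x ^+ 2.
  by move=> a0 /orP[] h; nra.
have h3 := sqr_ge0 z2.
clearbody z1 z2.
have q3h : q * (q / 2) = 3 / 2 by lra.
suff [h|h|h] : [\/ (3^-1 <= z1) || (3^-1 <= - z1),
    (2 / 3 <= z1 + q * z2) || (2 / 3 <= - (z1 + q * z2))
  | (2 / 3 <= q * z2 - z1) || (2 / 3 <= - (q * z2 - z1))].
- have := sq _ _ _ h; lra.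
- have := sq _ _ _ h; lra.
- have := sq _ _ _ h; lra.
move: vV wV vw z1E z2E.
rewrite !inE => /or3P[] /eqP-> /or3P[] /eqP->; rewrite ?eqxx//= => _ ->;
  rewrite ?mulr0 ?q3h => ->.
- by apply: Or31; apply/orP; right; lra.
- by apply: Or32; apply/orP; right; lra.
- by apply: Or31; apply/orP; left; lra.
- by apply: Or33; apply/orP; right; lra.
- by apply: Or32; apply/orP; left; lra.
- by apply: Or33; apply/orP; left; lra.
Qed.

Lemma contraction_inj (R : realType) (v : R * R) : injective (contraction v).
Proof. by move=> [s1 s2] [t1 t2] [] e1 e2; congr pair; lra. Qed.

Lemma enorm_contraction (R : realType) (v s t : R * R) :
  enorm (contraction v s - contraction v t) ^+ 2 = 9^-1 * enorm (s - t) ^+ 2.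
Proof. by rewrite !enorm_sqr /=; field. Qed.

Lemma corners_uniq (R : realType) m : uniq (corners R m).
Proof.
elim: m => // m IH; apply: allpairs_uniq => //.
  rewrite /= !inE !xpair_eqE.
  have q0 : 0 < Num.sqrt 3 / 2 :> R by rewrite divr_gt0// sqrtr_gt0.
  have a : (0 == 1 :> R) = false by apply/negbTE; lra.
  have b : (1 == 2^-1 :> R) = false by apply/negbTE; lra.
  have c : (0 == 2^-1 :> R) = false by apply/negbTE; lra.
  by rewrite a b c.
move=> [v s] [w t] /allpairsP[[v' s'] [vV sC [-> ->]]].
move=> /allpairsP[[w' t'] [wV tC [-> ->]]] /= e; rewrite /= in vV sC wV tC.
have [vw|vw] := eqVneq v' w'; last first.
  have := contraction_gap vV wV vw (corners_in_triangle sC) (corners_in_triangle tC).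
  by rewrite e subrr enorm_sqr /= expr0n addr0 lt_geF// invr_gt0.
by move: e; rewrite vw => /contraction_inj->.
Qed.

(** Points with the same first letter are handled by rescaling. Otherwise the gap
    [1 / 3] is enough, except at level one where the points are the vertices of
    a triangle of side [2 / 3] and the bound is attained. *)
Lemma corners_separated (R : realType) m :
  {in corners R m &, forall s t, s != t ->
     4 * 9^-1 ^+ m <= enorm (s - t) ^+ 2}.
Proof.
elim: m => [s t|m IH x y /allpairsP[[v s] [vV sC ->]]].
  by move=> /mem_corners0-> /mem_corners0->; rewrite eqxx.
move=> /allpairsP[[w t] [wV tC ->]] /=; rewrite /= in vV sC wV tC.
have [<-|vw _] := eqVneq v w.
  rewrite (inj_eq (@contraction_inj _ _)) enorm_contraction exprS => st.
  have := IH _ _ sC tC st; lra.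
have [m0|m0] := posnP m; last first.
  apply: le_trans (contraction_gap vV wV vw (corners_in_triangle sC)
    (corners_in_triangle tC)).
  rewrite -(prednK m0) !exprS.
  have : 9^-1 ^+ m.-1 <= 1 :> R by rewrite exprn_ile1//; lra.
  have : 0 <= 9^-1 ^+ m.-1 :> R by rewrite exprn_ge0.
  lra.
move: sC tC; rewrite m0 => /mem_corners0-> /mem_corners0->; rewrite enorm_sqr /= expr1.
have q3 := @sqrt3_sqr R.
by move: vV wV vw; rewrite !inE => /or3P[] /eqP-> /or3P[] /eqP->; rewrite ?eqxx//= => _; nra.
Qed.

(** * Measurability of the distance to a set *)

Lemma sqdist_le (R : realType) (alpha : set (R * R)) (a x : R * R) :
  alpha a -> sqdist alpha x <= enorm (x - a) ^+ 2.
Proof.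
move=> aa; apply: ge_inf; last by exists a.
by exists 0 => _ [b _ <-]; exact: sqr_ge0.
Qed.

Lemma sqdist_ge0 (R : realType) (alpha : set (R * R)) (x : R * R) :
  0 <= sqdist alpha x.
Proof.
have [->|/set0P[a aa]] := eqVneq alpha set0.
  by rewrite /sqdist image_set0 inf0.
apply: lb_le_inf; first by exists (enorm (x - a) ^+ 2), a.
by move=> _ [b _ <-]; exact: sqr_ge0.
Qed.

Lemma continuous_dist_sqr (R : realType) (a : R * R) :
  continuous (fun x : R * R => enorm (x - a) ^+ 2).
Proof.
have -> : (fun x : R * R => enorm (x - a) ^+ 2) =
    (fun x => (x.1 - a.1) ^+ 2 + (x.2 - a.2) ^+ 2).
  by apply/funext => x; rewrite enorm_sqr.
have sq (g : R * R -> R) (b : R) : continuous g ->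
    continuous (fun x => (g x - b) ^+ 2).
  move=> cg x; have cgb : (g y - b) @[y --> x] --> g x - b.
    by apply: cvgB; [exact: cg|exact: cvg_cst].
  exact: (cvgM cgb cgb).
move=> x; apply: cvgD.
  by apply: (sq fst) => y; exact: cvg_fst.
by apply: (sq snd) => y; exact: cvg_snd.
Qed.

(** An infimum of continuous functions is upper semicontinuous, whatever the set
    of centres is. *)
Lemma measurable_sqdist (R : realType) (alpha : set (R * R)) :
  alpha !=set0 -> measurable_fun setT (sqdist alpha).
Proof.
move=> [a0 aa0].
apply: (measurability _ (RGenInftyO.measurableE R)) => _ [_ [r ->] <-].
rewrite setTI measurable_plane_borel; apply: sub_sigma_algebra.
rewrite /= (_ : _ @^-1` _ =
  \bigcup_(a in alpha) [set x | enorm (x - a) ^+ 2 < r]).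
  apply: bigcup_open => a _.
  by apply: (open_comp _ (@open_lt _ r)) => x _; exact: continuous_dist_sqr.
rewrite eqEsubset; split=> x /=; rewrite in_itv/=.
  move=> /inf_lt[|_ [a aa <-] xa]; last by exists a.
  by exists (enorm (x - a0) ^+ 2), a0.
by move=> [a aa]; apply: le_lt_trans; exact: sqdist_le.
Qed.

(** * Iterated self-similarity *)

Lemma measurable_affine (R : realType) (k : R) (b : R * R) :
  measurable_fun setT (fun x : R * R => (k * x.1 + b.1, k * x.2 + b.2)).
Proof.
apply: measurable_fun_pair => /=; apply: measurable_funD => //;
  exact: measurable_funM.
Qed.

Lemma measurable_contraction (R : realType) (v : R * R) :
  measurable_fun setT (contraction v).
Proof. exact: (measurable_affine 3^-1 (2 / 3 * v.1, 2 / 3 * v.2)). Qed.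

Lemma integral_cst_probability d (T : measurableType d) (R : realType)
    (P : probability T R) (r : R) : (\int[P]_x r%:E = r%:E)%E.
Proof. by rewrite -[RHS]mule1 -(probability_setT P) -integral_cst. Qed.

Lemma integral_self_similar (R : realType) (P : probability (R * R)%type R)
    (f : R * R -> \bar R) :
  self_similar P -> measurable_fun setT f -> (forall x, 0 <= f x)%E ->
  (\int[P]_x f x =
   (3^-1)%:E * \sum_(v <- vertices R) \int[P]_x f (contraction v x))%E.
Proof.
move=> selfP mf f0.
(* [pushP] abstracts over the measurability proofs that make the pushforwards
   measures; [Q] supplies them. *)
pose pushP v : {measure set (R * R)%type -> \bar R} :=
  pushforward P (contraction v).
pose Q := pushP (@measurable_contraction R).
have k0 : 0 <= 3^-1 :> R by rewrite invr_ge0.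
pose k := NngNum k0.
rewrite (eq_measure_integral (mscale k (measure_add
    (measure_add (Q (0, 0)) (Q (1, 0))) (Q (2^-1, Num.sqrt 3 / 2))))); last first.
  move=> A mA _; apply: etrans (selfP A mA) _; congr (_ * _)%E.
  apply/esym; apply: etrans (measure_addE _ _ _) _; congr (_ + _)%E.
  exact: measure_addE.
rewrite ge0_integral_mscale// !ge0_integral_measure_add// !big_cons big_nil.
rewrite adde0 addeA.
by rewrite !(ge0_integral_pushforward (@measurable_contraction R _)).
Qed.

(** For a corner [t] of level [m] this is the composition of the [m] similarities
    that [t] comes from. *)
Definition shrink (R : realType) (m : nat) (t u : R * R) : R * R :=
  (3^-1 ^+ m * u.1 + t.1, 3^-1 ^+ m * u.2 + t.2).

Lemma measurable_shrink (R : realType) m (t : R * R) :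
  measurable_fun setT (shrink m t).
Proof. exact: measurable_affine. Qed.

Lemma contraction_shrink (R : realType) m (v t u : R * R) :
  contraction v (shrink m t u) = shrink m.+1 (contraction v t) u.
Proof. by rewrite /shrink/contraction exprS/=; congr pair; ring. Qed.

(** This moves all the dependence on the words of length [m] inside the integral,
    where it can be estimated for a fixed [u]. *)
Lemma integral_corners (R : realType) (P : probability (R * R)%type R) m
    (f : R * R -> \bar R) :
  self_similar P -> measurable_fun setT f -> (forall x, 0 <= f x)%E ->
  (\int[P]_x f x =
   (3^-1 ^+ m)%:E * \int[P]_u \sum_(t <- corners R m) f (shrink m t u))%E.
Proof.
move=> selfP mf f0; rewrite ge0_integral_sum//; last first.
  by move=> t; apply: measurableT_comp mf _; exact: measurable_shrink.
elim: m f mf f0 => [|m IH] f mf f0.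
  rewrite big_seq1 expr0 mul1e; apply: eq_integral => x _.
  by rewrite /shrink/= expr0 !mul1r !addr0 -surjective_pairing.
rewrite (integral_self_similar selfP)// exprS EFinM -muleA; congr (_ * _)%E.
rewrite cornersS big_allpairs_dep/= ge0_sume_distrr; last first.
  by move=> v _; apply: sume_ge0 => t _; exact: integral_ge0.
apply: eq_bigr => v _; rewrite IH//; last first.
  by apply: measurableT_comp mf _; exact: measurable_contraction.
congr (_ * _)%E; apply: eq_bigr => t _; apply: eq_integral => u _.
by rewrite contraction_shrink.
Qed.

(** * Lower bound for the quantization error *)

(** The bound [sum_sqdist_ge] applies for each [u] to the translated corners
    [shrink m t u], with [d = 4 * 9 ^ - m]. *)
Lemma quantization_error_ge (R : realType) (P : probability (R * R)%type R)
    (m n : nat) :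
  self_similar P -> (n <= 3 ^ m)%N ->
  ((2 * 27^-1 ^+ m * ((3 ^ m)%:R - n%:R))%:E <= quantization_error P n)%E.
Proof.
move=> selfP nm; apply: le_ereal_inf_tmp => _ [alpha [alpha0 alphan] <-].
have d0 : 0 <= 4 * 9^-1 ^+ m :> R by rewrite mulr_ge0// exprn_ge0.
have mf : measurable_fun setT (fun x : R * R => (sqdist alpha x)%:E).
  by apply/measurable_EFinP; exact: measurable_sqdist.
have f0 x : (0 <= (sqdist alpha x)%:E)%E by rewrite lee_fin sqdist_ge0.
rewrite (integral_corners m selfP)//.
have -> : 2 * 27^-1 ^+ m * ((3 ^ m)%:R - n%:R) =
    3^-1 ^+ m * (4 * 9^-1 ^+ m / 2 * ((3 ^ m)%:R - n%:R)) :> R.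
  have -> : 27^-1 ^+ m = 3^-1 ^+ m * 9^-1 ^+ m :> R.
    by rewrite -exprMn -invfM -natrM.
  lra.
rewrite EFinM lee_wpmul2l ?lee_fin ?exprn_ge0 ?invr_ge0//.
set b := 4 * _ / 2 * _.
have b0 : 0 <= b by rewrite mulr_ge0 ?divr_ge0// subr_ge0 ler_nat.
rewrite -[leLHS](integral_cst_probability P).
apply: ge0_le_integral => //.
- apply: emeasurable_sum => t.
  by apply: measurableT_comp mf _; exact: measurable_shrink.
- move=> u _; rewrite sumEFin lee_fin.
  rewrite -(big_map (fun t => shrink m t u) xpredT (sqdist alpha)) /b.
  have inj : injective (fun t : R * R => shrink m t u).
    by move=> [? ?] [? ?] [] /addrI-> /addrI->.
  have szE : (3 ^ m)%N = size [seq shrink m t u | t <- corners R m].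
    by rewrite size_map size_corners.
  rewrite szE; apply: sum_sqdist_ge => //.
    by rewrite map_inj_uniq// corners_uniq.
  move=> _ _ /mapP[s sC ->] /mapP[t tC ->].
  rewrite (inj_eq inj) => st; apply: le_trans (corners_separated sC tC st) _.
  rewrite !enorm_sqr/=; lra.
Qed.

(** * Upper bound for the quantization error *)

Lemma measurable_dist_sqr (R : realType) (a : R * R) :
  measurable_fun setT (fun u : R * R => enorm (u - a) ^+ 2).
Proof.
under eq_fun do rewrite enorm_sqr.
by apply: measurable_funD; apply: measurable_funX; apply: measurable_funB.
Qed.

Definition centroid (R : realType) : R * R := (2^-1, Num.sqrt 3 / 6).

(** With the image of the centroid as the centre of each cell, every cell
    contributes a copy of the second moment scaled by [9 ^ - m]. *)
Lemma quantization_error_le (R : realType) (P : probability (R * R)%type R)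
    (m : nat) :
  self_similar P ->
  (quantization_error P (3 ^ m) <=
   (9^-1 ^+ m)%:E * \int[P]_u (enorm (u - centroid R) ^+ 2)%:E)%E.
Proof.
move=> selfP; set c := centroid R.
pose alpha := [set shrink m (nth (0, 0) (corners R m) i) c | i in `I_(3 ^ m)].
have alpha0 : alpha !=set0.
  by exists (shrink m (nth (0, 0) (corners R m) 0) c), 0%N; rewrite //= expn_gt0.
apply: (@le_trans _ _ (\int[P]_x (sqdist alpha x)%:E)%E).
  by apply: ereal_inf_lbound; exists alpha => //; split => //; exact: card_image_le.
have mf : measurable_fun setT (fun x : R * R => (sqdist alpha x)%:E).
  by apply/measurable_EFinP; exact: measurable_sqdist.
have mg := measurable_dist_sqr c.
have f0 x : (0 <= (sqdist alpha x)%:E)%E by rewrite lee_fin sqdist_ge0.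
have g0 x : (0 <= (enorm (x - c) ^+ 2)%:E)%E by rewrite lee_fin sqr_ge0.
rewrite (integral_corners m selfP)//.
(* The factor [3 ^ m] counts the corners. *)
have -> : 9^-1 ^+ m = 3^-1 ^+ m * (3 ^+ m * 9^-1 ^+ m) :> R.
  by rewrite mulrA -exprMn mulVf// expr1n mul1r.
rewrite EFinM -muleA lee_wpmul2l ?lee_fin ?exprn_ge0 ?invr_ge0//.
rewrite -ge0_integralZl//; last exact/measurable_EFinP.
apply: ge0_le_integral => //.
- by move=> u _; apply: sume_ge0.
- apply: emeasurable_sum => t.
  by apply: measurableT_comp mf _; exact: measurable_shrink.
- by apply: measurable_funeM; exact/measurable_EFinP.
move=> u _; rewrite sumEFin -EFinM lee_fin.
have -> : 3 ^+ m * 9^-1 ^+ m * enorm (u - c) ^+ 2 =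
    \sum_(t <- corners R m) 9^-1 ^+ m * enorm (u - c) ^+ 2.
  rewrite big_const_seq count_predT iter_addr addr0 size_corners.
  by rewrite -mulrA -[RHS]mulr_natl natrX.
rewrite big_seq [leRHS]big_seq; apply: ler_sum => t tC.
have at_ : alpha (shrink m t c).
  by exists (index t (corners R m)); rewrite /= ?nth_index// -(size_corners R) index_mem.
apply: le_trans (sqdist_le _ at_) _.
have -> : 9^-1 = 3^-1 ^+ 2 :> R by rewrite exprVn -natrX.
rewrite !enorm_sqr/= -exprM mulnC exprM expr2; lra.
Qed.

(** The images of the centroid are at distance [2 / 3 / sqrt 3] from it and
    average to it, so that the mixed terms cancel. *)
Lemma centroid_contraction_sum (R : realType) (u : R * R) :
  \sum_(v <- vertices R) enorm (contraction v u - centroid R) ^+ 2 =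
  3^-1 * enorm (u - centroid R) ^+ 2 + 4 / 9.
Proof.
rewrite !big_cons big_nil !enorm_sqr /=.
have q3 := @sqrt3_sqr R; set q := Num.sqrt 3 in q3 *.
have qq : q ^+ 2 = 3 by rewrite expr2.
lra.
Qed.

(** * The second moment about the centroid *)

Definition box (R : realType) (r : R) : set (R * R) :=
  `[- r, r] `*` `[- r, r].

Lemma boxP (R : realType) (r : R) (x : R * R) :
  box r x <-> - r <= x.1 <= r /\ - r <= x.2 <= r.
Proof. by rewrite /box/= !in_itv. Qed.

Lemma measurable_box (R : realType) (r : R) : measurable (box r).
Proof. by apply: measurableX; exact: measurable_itv. Qed.

Lemma sqrt3_bounds (R : realType) : 0 <= Num.sqrt (3 : R) <= 2.
Proof.
rewrite sqrtr_ge0/= -(@ler_pXn2r _ 2)// ?nnegrE ?sqrtr_ge0//.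
by rewrite sqr_sqrtr//; lra.
Qed.

(** Each similarity divides the excess over the unit box by three, because the
    vertices have coordinates at most [1] in absolute value. *)
Lemma contraction_box (R : realType) (v x : R * R) (t : R) :
  v \in vertices R -> box (1 + 3 * t) x -> box (1 + t) (contraction v x).
Proof.
have q := @sqrt3_bounds R.
move=> vV /boxP[x1 x2]; apply/boxP; rewrite /contraction /=.
by move: vV; rewrite !inE => /or3P[] /eqP-> /=; split; lra.
Qed.

Lemma probability_box_le (R : realType) (P : probability (R * R)%type R) (t : R) :
  self_similar P -> (P (box (1 + 3 * t)) <= P (box (1 + t)))%E.
Proof.
move=> selfP; rewrite [leRHS](selfP _ (@measurable_box R _)).
have le v : v \in vertices R ->
    (P (box (1 + 3 * t)) <= pushforward P (contraction v) (box (1 + t)))%E.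
  move=> vV; apply: le_measure; rewrite ?inE.
  - exact: measurable_box.
  - rewrite -[X in measurable X]setTI.
    exact: (measurable_contraction _ _ (@measurable_box R _)).
  - by move=> x /(contraction_box vV).
apply: le_trans (lee_wpmul2l _ (leeD (leeD (le _ _) (le _ _)) (le _ _))); last first.
- by rewrite !inE eqxx !orbT.
- by rewrite !inE eqxx !orbT.
- by rewrite !inE eqxx.
- by rewrite lee_fin.
have /fineK <- := fin_num_measure P _ (@measurable_box R (1 + 3 * t)).
by rewrite -!EFinD -EFinM lee_fin; lra.
Qed.

(** Iterating [probability_box_le] bounds the mass of the box of radius [2] from
    below by that of arbitrarily large boxes. *)
Lemma probability_box2 (R : realType) (P : probability (R * R)%type R) :
  self_similar P -> P (box 2) = 1%E.
Proof.
move=> selfP; apply/eqP; rewrite eq_le probability_le1/=; last first.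
  exact: measurable_box.
have boxk k : (P (box (1 + 3 ^+ k)) <= P (box 2))%E.
  elim: k => [|k IH]; first by rewrite expr0.
  by apply: le_trans IH; rewrite exprS; exact: probability_box_le.
have cupE : \bigcup_k box (1 + 3 ^+ k) = [set: R * R].
  rewrite eqEsubset; split => // x _.
  have [k xk] : exists k, `|x.1| + `|x.2| <= 3 ^+ k.
    exists (Num.bound (`|x.1| + `|x.2|)).
    apply/ltW/(lt_le_trans (archi_boundP _)); first by rewrite addr_ge0.
    by rewrite -natrX ler_nat ltnW// ltn_expl.
  have := normr_ge0 x.1; have := normr_ge0 x.2.
  exists k => //; apply/boxP; rewrite -!ler_norml; split; lra.
have cvgP : (P \o (fun k => box (1 + 3 ^+ k)) @ \oo --> P setT).
  rewrite -cupE; apply: nondecreasing_cvg_mu.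
  - by move=> k; exact: measurable_box.
  - by apply: bigcup_measurable => k _; exact: measurable_box.
  - move=> k l kl; apply/subsetPset => x /boxP[x1 x2].
    have : 3 ^+ k <= 3 ^+ l :> R by rewrite ler_eXn2l//; lra.
    by move=> kl'; apply/boxP; split; lra.
rewrite -(probability_setT P); apply: cvge_le cvgP.
by apply: nearW => k; exact: boxk.
Qed.

Lemma variance_finite (R : realType) (P : probability (R * R)%type R) :
  self_similar P -> (\int[P]_u (enorm (u - centroid R) ^+ 2)%:E < +oo)%E.
Proof.
move=> selfP; apply: (@le_lt_trans _ _ (\int[P]_u 18%:E)%E); last first.
  by rewrite integral_cst_probability ltry.
apply: ae_ge0_le_integral => //.
- by move=> x _; rewrite lee_fin sqr_ge0.
- by apply/measurable_EFinP; exact: measurable_dist_sqr.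
exists (~` box 2); split.
- by apply: measurableC; exact: measurable_box.
- apply: etrans (probability_setC P (@measurable_box R 2)) _.
  by rewrite probability_box2// subee.
have q := @sqrt3_bounds R.
move=> x /= nle bx; apply: nle => _; move/boxP: bx => -[x1 x2].
rewrite lee_fin enorm_sqr /=; nra.
Qed.

(** Self-similarity is a linear equation for the second moment; finiteness is what
    excludes the solution [+oo]. *)
Lemma varianceE (R : realType) (P : probability (R * R)%type R) :
  self_similar P -> (\int[P]_u (enorm (u - centroid R) ^+ 2)%:E = (6^-1)%:E)%E.
Proof.
move=> selfP; set f := fun u => (enorm (u - centroid R) ^+ 2)%:E.
have mf : measurable_fun setT f.
  by apply/measurable_EFinP; exact: measurable_dist_sqr.
have f0 x : (0 <= f x)%E by rewrite lee_fin sqr_ge0.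
have vfin : (\int[P]_u f u)%E \is a fin_num.
  by rewrite ge0_fin_numE ?variance_finite// integral_ge0.
have := integral_self_similar selfP mf f0.
rewrite -ge0_integral_sum//; last first.
  by move=> v; apply: measurableT_comp mf _; exact: measurable_contraction.
under [X in _ = (_ * X)%E]eq_integral do
  rewrite /f sumEFin centroid_contraction_sum EFinD EFinM.
rewrite ge0_integralD//; last 2 first.
- by move=> x _; rewrite mule_ge0// lee_fin sqr_ge0.
- exact: measurable_funeM.
rewrite ge0_integralZl//; last by move=> x _; rewrite lee_fin sqr_ge0.
rewrite integral_cst_probability.
rewrite -[X in ((3^-1)%:E * X + _)%E]/(\int[P]_u f u)%E.
rewrite -(fineK vfin) -!EFinM => -[e]; congr EFin.
lra.
Qed.

(** * Two subsequences with different limits *)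

Lemma quantization_coefficient_along (R : realType)
    (P : probability (R * R)%type R) (c : \bar R) (g : nat -> nat) :
  is_quantization_coefficient P 1 c -> (forall k, k <= g k)%N ->
  (((g k)%:R ^+ 2)%:E * quantization_error P (g k))%E @[k --> \oo] --> c.
Proof.
move=> Pc gk; have goo : g k @[k --> \oo] --> \oo.
  apply/cvgnyPge => N; exists N => // k /= Nk; exact: leq_trans (gk k).
have := cvg_comp _ _ goo Pc.
by under eq_fun do rewrite /= divr1 powR_mulrn//.
Qed.

Theorem theorem4p1 (R : realType) (P : probability (R * R)%type R)
    (selfP : self_similar P) :
  ~ (exists c : \bar R, is_quantization_coefficient P 1 c).
Proof.
move=> [c Pc].
have le3 k : (k <= 3 ^ k)%N by rewrite ltnW// ltn_expl.
have upper : (c <= (6^-1)%:E)%E.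
  apply: cvge_le (quantization_coefficient_along Pc le3); apply: nearW => k.
  have := quantization_error_le k selfP; rewrite varianceE// => Vk.
  apply: le_trans (lee_wpmul2l _ Vk) _; first by rewrite lee_fin exprn_ge0.
  rewrite -!EFinM lee_fin natrX -exprM mulnC exprM mulrA -exprMn -natrX.
  by rewrite divff ?expr1n ?mul1r// pnatr_eq0.
have lower : ((8 / 27)%:E <= c)%E.
  have le23 k : (k <= 2 * 3 ^ k)%N by apply: leq_trans (le3 k) _; rewrite leq_pmull.
  apply: cvge_ge (quantization_coefficient_along Pc le23); apply: nearW => k.
  have n_le : (2 * 3 ^ k <= 3 ^ k.+1)%N by rewrite expnS leq_mul2r orbT.
  have Vk := quantization_error_ge selfP n_le.
  apply: le_trans (lee_wpmul2l _ Vk); last by rewrite lee_fin exprn_ge0.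
  rewrite -EFinM lee_fin natrM !natrX !exprS.
  have -> : 27^-1 ^+ k = (3 ^+ k * 3 ^+ k * 3 ^+ k)^-1 :> R.
    by rewrite -!exprMn -!natrM exprVn.
  have : 3 ^+ k != 0 :> R by rewrite expf_neq0// pnatr_eq0.
  set x := 3 ^+ k => x0.
  by rewrite le_eqVlt; apply/orP; left; apply/eqP; field.
have := le_trans lower upper; rewrite lee_fin; lra.
Qed.
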